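(* Let $s\in(0,d)$. The only reflectionless measure $\mu$ for the $s$-Riesz transform in $\mathbb{R}^d$ satisfying $$\iint_{\mathbb{R}^d\times\mathbb{R}^d}\frac{1}{|x-y|^{s-1}}\,d\mu(x)\,d\mu(y)<\infty$$ is the zero measure.
   Context: A measure means a non-negative locally finite Borel measure on $\mathbb{R}^d$. The $s$-Riesz transform $R$ has kernel $K(x)=\frac{x}{|x|^{s+1}}$, $x\in\mathbb{R}^d\setminus\{0\}$. Reflectionless measures. $\operatorname{Lip}_0(\mathbb{R}^d)$ is the set of compactly supported scalar Lipschitz functions. A measure $\mu$ is diffuse if it has no atoms (so that the diagonal of $\mathbb{R}^d\times\mathbb{R}^d$ is $\mu\times\mu$-null) and $(x,y)\mapsto|x-y|^{-(s-1)}$ lies in $L^1_{\rm loc}(\mu\times\mu)$; it has restricted growth at infinity if $\int_{|x|\ge1}|x|^{-s-1}d\mu(x)<\infty$. For $\mu$ diffuse and $f,\varphi\in\operatorname{Lip}_0(\mathbb{R}^d)$ put $\langle R(f\mu),\varphi\rangle_\mu=\iint K(x-y)\,\tfrac12[f(y)\varphi(x)-\varphi(y)f(x)]\,d\mu(x)d\mu(y)$. If also $\mu$ has restricted growth at infinity and $f\in\operatorname{Lip}_0(\mathbb{R}^d)$ has $\int f\,d\mu=0$, put $\langle R(f\mu),1\rangle_\mu=\langle R(f\mu),\psi\rangle_\mu+\int R(f\mu)(x)[1-\psi(x)]\,d\mu(x)$, where $\psi\in\operatorname{Lip}_0(\mathbb{R}^d)$ equals $1$ on a neighbourhood of $\operatorname{supp}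 f$ and $R(f\mu)(x)=\int K(x-y)f(y)\,d\mu(y)$ (independent of $\psi$). A diffuse measure with restricted growth at infinity is reflectionless for the $s$-Riesz transform if $\langle R(f\mu),1\rangle_\mu=0$ for every $f\in\operatorname{Lip}_0(\mathbb{R}^d)$ with $\int f\,d\mu=0$. *)

(* Defs.v *)
From HB Require Import structures.
From mathcomp Require Import all_boot all_order all_algebra.
From mathcomp Require Import all_classical all_reals all_analysis.

Set Implicit Arguments.
Unset Strict Implicit.
Unset Printing Implicit Defensive.

Import Order.TTheory GRing.Theory Num.Theory.
Import numFieldNormedType.Exports.

Local Open Scope classical_set_scope.
Local Open Scope ring_scope.

(* R^d is 'rV[R]_d with its library (product) topology and the Borel
   sigma-algebra of that topology. *)
Section borel_rV.
Variables (R : realType) (d : nat).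

HB.instance Definition _ := @isMeasurable.Build
  (sigma_display (@open 'rV[R]_d)) 'rV[R]_d
  <<s (@open 'rV[R]_d) >>
  (@sigma_algebra0 _ setT (@open 'rV[R]_d))
  (@sigma_algebraC _ (@open 'rV[R]_d))
  (@sigma_algebra_bigcup _ setT (@open 'rV[R]_d)).

End borel_rV.

Section reflectionless.
Variables (R : realType) (d : nat).
Implicit Types (s : R) (mu : {measure set 'rV[R]_d -> \bar R}).
Implicit Types (f phi psi : 'rV[R]_d -> R).

(* The library norm on 'rV[R]_d is the sup norm, hence this definition. *)
Definition enorm (x : 'rV[R]_d) : R := Num.sqrt (\sum_(i < d) x ord0 i ^+ 2).

Definition locally_finite mu :=
  forall x : 'rV[R]_d, exists2 U : set 'rV[R]_d, open_nbhs x U & (mu U < +oo)%E.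

(* Equal to 0 at the origin, where the kernel is left undefined on paper. *)
Definition riesz_kernel s (x : 'rV[R]_d) : 'rV[R]_d :=
  (enorm x `^ (s + 1))^-1 *: x.

(* Coordinatewise integral of a vector-valued function; it is only meaningful
   when the coordinates are integrable. *)
Definition vintegral dT (T : measurableType dT) (m : set T -> \bar R)
    (F : T -> 'rV[R]_d) : 'rV[R]_d :=
  \row_(i < d) fine (\int[m]_t (F t ord0 i)%:E)%E.

Definition closed_support f : set 'rV[R]_d := closure [set x | f x != 0].

Definition Lip0 f :=
  compact (closed_support f) /\
  exists L : R, forall x y, `|f x - f y| <= L * enorm (x - y).

(* The value at x = y of the integrand (0, or 1 if s = 1) is immaterial: the
   diagonal is null for mu \x mu when mu has no atoms. *)
Definition energy_density s (z : 'rV[R]_d * 'rV[R]_d) : \bar R :=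
  (enorm (z.1 - z.2) `^ (- (s - 1)))%:E.

Definition diffuse s mu :=
  (forall x : 'rV[R]_d, mu [set x] = 0%E) /\
  (forall Q : set ('rV[R]_d * 'rV[R]_d), compact Q ->
     (mu \x mu)%E.-integrable Q (energy_density s)).

Definition restricted_growth s mu :=
  (\int[mu]_(x in [set x : 'rV[R]_d | (1 <= enorm x)%R])
     (enorm x `^ (- s - 1))%:E < +oo)%E.

Definition riesz_pairing s mu f phi : 'rV[R]_d :=
  vintegral (mu \x mu)%E (fun z : 'rV[R]_d * 'rV[R]_d =>
    (2^-1 * (f z.2 * phi z.1 - phi z.2 * f z.1)) *: riesz_kernel s (z.1 - z.2)).

Definition riesz_transform s mu f (x : 'rV[R]_d) : 'rV[R]_d :=
  vintegral mu (fun y => f y *: riesz_kernel s (x - y)).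

Definition cutoffs f : set ('rV[R]_d -> R) :=
  [set psi | Lip0 psi /\
             forall x, closed_support f x -> \forall y \near x, psi y = 1].

(* The pairing of R(f mu) with 1. The cutoff psi is picked by the choice
   operator among the admissible ones; the value does not depend on it. *)
Definition riesz_pairing1 s mu f : 'rV[R]_d :=
  let psi := xget (fun=> 0) (cutoffs f) in
  riesz_pairing s mu f psi +
  vintegral mu (fun x => (1 - psi x) *: riesz_transform s mu f x).

Definition reflectionless s mu :=
  [/\ diffuse s mu, restricted_growth s mu &
      forall f, Lip0 f -> \int[mu]_x f x = 0 -> riesz_pairing1 s mu f = 0].

End reflectionless.

(* Main.v *)
Require Import Defs.
From HB Require Import structures.
From mathcomp Require Import all_boot all_order all_algebra.
From mathcomp Require Import ring lra.
From mathcomp Require Import all_classical all_reals all_analysis.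
From mathcomp Require Import measurable_realfun.

Set Implicit Arguments.
Unset Strict Implicit.
Unset Printing Implicit Defensive.

Import Order.TTheory GRing.Theory Num.Theory.
Import numFieldNormedType.Exports.

Local Open Scope classical_set_scope.
Local Open Scope ring_scope.

(** The reason is a virial identity. Formally, a reflectionless measure is one
    for which [R mu] is orthogonal in [L^2(mu)] to functions of mean zero, hence
    is constant. As the kernel [K] is odd, [R mu] has integral zero, so that the
    constant vanishes; and testing [R mu = 0] against [x] gives

      [0 = int x . R mu (x) dmu = 1/2 iint (x - y) . K(x - y) dmu dmu
         = 1/2 iint |x - y|^(1 - s) dmu dmu],

    so the energy is zero and [mu], having no atoms, is zero.

    The finite energy makes this rigorous at little cost. Since
    [|z| |K(z)| <= |z|^(1 - s)] ([riesz_kernel_bound]), the antisymmetric form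
    [T(f) = 1/2 iint K(x - y) (f(y) - f(x)) dmu dmu] ([riesz_form]) converges
    absolutely as soon as [f] is Lipschitz, with a bound that depends only on
    the Lipschitz constant ([riesz_form_bound]). For [f] in [Lip0] it coincides
    with the pairing of [R(f mu)] with [1], cutoff included ([riesz_pairing1E]).

    By hypothesis [T] vanishes on functions of mean zero, so [T(f)] is a
    constant times the integral of [f]. If [mu] is not zero, the tents
    [max(0, r - |x|)] have integrals growing to infinity with [r], but are all
    1-Lipschitz: the constant is zero and [T] vanishes on [Lip0]
    ([riesz_form_eq0]). Applying this to the coordinates, clipped by tents so as
    to be in [Lip0] and still 1-Lipschitz, and passing to the limit by dominated
    convergence, one gets that the integral of [(x - y) . K(x - y)] is zero
    ([coordinate_form_eq0]). This function is positive off the diagonal, hence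
    [mu \x mu] does not charge the complement of the diagonal, whose mass is
    [mu(R^d)^2] in the absence of atoms ([reflectionless_null]). *)

(** * The Euclidean norm *)

Section euclidean_norm.
Variables (R : realType) (d : nat).
Implicit Types (x y z : 'rV[R]_d) (i : 'I_d) (f g : 'rV[R]_d -> R).

Lemma enorm_ge0 x : 0 <= enorm x.
Proof. exact: sqrtr_ge0. Qed.

Lemma sqr_enorm x : enorm x ^+ 2 = \sum_(i < d) x ord0 i ^+ 2.
Proof. by rewrite sqr_sqrtr// sumr_ge0// => i _; exact: sqr_ge0. Qed.

Lemma enormN x : enorm (- x) = enorm x.
Proof. by congr Num.sqrt; apply: eq_bigr => i _; rewrite mxE sqrrN. Qed.

Lemma enorm0 : enorm (0 : 'rV[R]_d) = 0.
Proof.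
by rewrite /enorm big1 ?sqrtr0// => i _; rewrite mxE expr0n.
Qed.

Lemma ler_coord_enorm x i : `|x ord0 i| <= enorm x.
Proof.
rewrite -(@ler_pXn2r _ 2)// ?nnegrE ?enorm_ge0// real_normK ?num_real//.
by rewrite sqr_enorm (bigD1 i)//= lerDl sumr_ge0// => j _; exact: sqr_ge0.
Qed.

Lemma enorm_eq0 x : (enorm x == 0) = (x == 0).
Proof.
apply/eqP/eqP => [x0|->]; last exact: enorm0.
apply/rowP => i; rewrite mxE; apply/eqP; rewrite -normr_le0 -x0.
exact: ler_coord_enorm.
Qed.

Lemma ler_norm_enorm x : `|x| <= enorm x.
Proof.
rewrite [leLHS](_ : _ = mx_norm x)//.
have [->|/mx_norm_neq0[[i j] ->]] := eqVneq (mx_norm x) 0; first exact: enorm_ge0.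
by rewrite /= (ord1 i); exact: ler_coord_enorm.
Qed.

Lemma ler_coord_norm x i : `|x ord0 i| <= `|x|.
Proof.
rewrite [leRHS](_ : _ = mx_norm x)// mx_normrE.
exact: (le_bigmax _ (fun ij : 'I_1 * 'I_d => `|x ij.1 ij.2|) (ord0, i)).
Qed.

Lemma ler_enorm_norm x : enorm x <= Num.sqrt d%:R * `|x|.
Proof.
rewrite -(@ler_pXn2r _ 2)// ?nnegrE ?enorm_ge0 ?mulr_ge0 ?sqrtr_ge0//.
rewrite sqr_enorm exprMn sqr_sqrtr// mulr_natl.
apply: (@le_trans _ _ (\sum_(i < d) `|x| ^+ 2)); last first.
  by rewrite sumr_const card_ord.
apply: ler_sum => i _.
by rewrite -(real_normK (num_real (x _ _))) lerXn2r ?nnegrE// ler_coord_norm.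
Qed.

Definition elipschitz (L : R) f :=
  forall x y, `|f x - f y| <= L * enorm (x - y).

Lemma elipschitz_continuous (L : R) f : elipschitz L f -> continuous f.
Proof.
move=> fL x; apply/(@cvgrPdist_le _ _ _ (nbhs x) (nbhs_filter x)) => e e0.
pose M := `|L| * Num.sqrt d%:R + 1.
have M0 : 0 < M by rewrite ltr_wpDl// mulr_ge0// sqrtr_ge0.
near=> y.
have xy : `|x - y| <= e / M.
  by near: y; apply: (@cvgr_dist_le _ _ _ _ _ id); rewrite ?divr_gt0.
apply: (le_trans (fL x y)); apply: (@le_trans _ _ (M * `|x - y|)); last first.
  by rewrite mulrC -ler_pdivlMr.
apply: (@le_trans _ _ (`|L| * enorm (x - y))).
  by rewrite ler_wpM2r ?enorm_ge0// ler_norm.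
rewrite mulrDl -mulrA mul1r ler_wpDr//.
by rewrite ler_wpM2l// ler_enorm_norm.
Unshelve. all: by end_near. Qed.

Lemma elipschitz_sub (a : R) (Lf Lg : R) f g :
  elipschitz Lf f -> elipschitz Lg g ->
  elipschitz (Lf + `|a| * Lg) (fun x => f x - a * g x).
Proof.
move=> hf hg x y; have -> : f x - a * g x - (f y - a * g y) =
  (f x - f y) - a * (g x - g y) by ring.
rewrite (le_trans (ler_normB _ _))// mulrDl lerD// normrM -mulrA.
by rewrite ler_wpM2l.
Qed.

Lemma ler_dist_max (a b c e : R) :
  `|Num.max a b - Num.max c e| <= Num.max `|a - c| `|b - e|.
Proof.
have : `|a - c| <= Num.max `|a - c| `|b - e| by rewrite le_max lexx.
have : `|b - e| <= Num.max `|a - c| `|b - e| by rewrite le_max lexx orbT.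
move: (Num.max `|a - c| `|b - e|) => M; rewrite !ler_norml.
by case: (leP a b); case: (leP c e); lra.
Qed.

End euclidean_norm.

(** * Lipschitz functions with compact support *)

Section lipschitz_functions.
Variables (R : realType) (d : nat).
Implicit Types (x y z : 'rV[R]_d) (i : 'I_d) (f g : 'rV[R]_d -> R).

Lemma closed_norm_ball (r : R) : closed [set y : 'rV[R]_d | `|y| <= r].
Proof.
apply: (@preimage_closed _ _ (fun y : 'rV[R]_d => `|y|) [set t | t <= r]).
  by move=> y _; exact: norm_continuous.
exact: closed_le.
Qed.

Lemma compact_norm_ball (r : R) : compact [set y : 'rV[R]_d | `|y| <= r].
Proof.
apply: bounded_closed_compact; last exact: closed_norm_ball.
by exists r; split; [exact: num_real|move=> M rM y /= /le_trans->//; exact: ltW].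
Qed.

Lemma bounded_support_Lip0 (L r : R) f :
  elipschitz L f -> (forall y, f y != 0 -> `|y| <= r) -> Lip0 f.
Proof.
move=> fL fr; split; last by exists L.
apply: (@subclosed_compact _ _ [set y : 'rV[R]_d | `|y| <= r]).
- exact: closed_closure.
- exact: compact_norm_ball.
- by rewrite ((closure_id _).1 (@closed_norm_ball r)); exact: closure_subset.
Qed.

Lemma Lip0_support_bounded f : Lip0 f ->
  exists2 r, 0 <= r & forall y, closed_support f y -> `|y| <= r.
Proof.
move=> [/compact_bounded[M [_ hM]] _]; exists (`|M| + 1) => [|y fy].
  by rewrite addr_ge0.
by apply: hM fy; rewrite ltr_pwDr// ler_norm.
Qed.

Lemma Lip0_elipschitz f : Lip0 f -> exists2 L, 0 <= L & elipschitz L f.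
Proof.
move=> [_ [L fL]]; exists `|L| => // x y; rewrite (le_trans (fL x y))//.
by rewrite ler_wpM2r ?enorm_ge0// ler_norm.
Qed.

Lemma Lip0_continuous f : Lip0 f -> continuous f.
Proof. by move=> /Lip0_elipschitz[L _] /elipschitz_continuous. Qed.

Lemma support_subset_closed f y : f y != 0 -> closed_support f y.
Proof. by move=> fy; exact: (@subset_closure _ [set x | f x != 0]). Qed.

Lemma Lip0_sub (a : R) f g :
  Lip0 f -> Lip0 g -> Lip0 (fun x => f x - a * g x).
Proof.
move=> lf lg; have [Lf _ fL] := Lip0_elipschitz lf.
have [Lg _ gL] := Lip0_elipschitz lg.
have [rf _ fr] := Lip0_support_bounded lf.
have [rg _ gr] := Lip0_support_bounded lg.
apply: (bounded_support_Lip0 (r := Num.max rf rg) (elipschitz_sub a fL gL)) => y.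
have [fy0|/support_subset_closed/fr fy _] := eqVneq (f y) 0.
  have [gy0|/support_subset_closed/gr gy _] := eqVneq (g y) 0.
    by rewrite fy0 gy0 mulr0 subrr eqxx.
  by rewrite le_max gy orbT.
by rewrite le_max fy.
Qed.

Lemma Lip0_bounded f : Lip0 f -> exists2 M, 0 <= M & forall y, `|f y| <= M.
Proof.
move=> lf; have cf : compact (f @` closed_support f).
  apply: continuous_compact; last by case: lf.
  exact/continuous_subspaceT/Lip0_continuous.
have [M [_ hM]] := compact_bounded cf.
exists (`|M| + 1) => [|y]; first by rewrite addr_ge0.
have [->|fy0] := eqVneq (f y) 0; first by rewrite normr0 addr_ge0.
apply: (hM (`|M| + 1)); first by rewrite ltr_pwDr// ler_norm.
by exists y => //; exact: support_subset_closed.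
Qed.

(** Tents can be arbitrarily high without losing the Lipschitz constant 1.
    Against a nonzero measure their integrals are therefore unbounded, while
    quantities controlled by the Lipschitz constant stay bounded. *)
Definition tent (r : R) y : R := Num.max 0 (r - `|y|).

Lemma tent_ge0 r y : 0 <= tent r y.
Proof. by rewrite le_max lexx. Qed.

Lemma le_tent r y : r - `|y| <= tent r y.
Proof. by rewrite le_max lexx orbT. Qed.

Lemma tent_neq0 r y : tent r y != 0 -> `|y| <= r.
Proof.
apply: contra_neqT; rewrite -ltNge => yr; apply/max_idPl; lra.
Qed.

Lemma elipschitz_tent r : elipschitz 1 (tent r).
Proof.
move=> x y; rewrite mul1r (le_trans (ler_dist_max _ _ _ _))//.
rewrite subrr normr0 ge_max enorm_ge0/=.
rewrite (le_trans _ (ler_norm_enorm _))//.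
have -> : r - `|x| - (r - `|y|) = - (`|x| - `|y|) by ring.
by rewrite normrN; exact: ler_dist_dist.
Qed.

Lemma Lip0_tent r : Lip0 (tent r).
Proof. exact: bounded_support_Lip0 (@elipschitz_tent r) (@tent_neq0 r). Qed.

(** The coordinate [y_i] clipped to the band between [- tent] and [tent].
    Localizing by lattice operations, and not by multiplication with a cutoff,
    keeps the Lipschitz constant equal to 1. *)
Definition clipped_coord (r : R) i y : R :=
  Num.max (- tent r y) (- Num.max (- tent r y) (- y ord0 i)).

Lemma elipschitz_clipped_coord r i : elipschitz 1 (clipped_coord r i).
Proof.
have tentL x y : `|- tent r x - - tent r y| <= enorm (x - y).
  by rewrite -opprD normrN -[leRHS]mul1r; exact: elipschitz_tent.
move=> x y; rewrite mul1r (le_trans (ler_dist_max _ _ _ _))// ge_max tentL/=.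
rewrite -opprD normrN (le_trans (ler_dist_max _ _ _ _))// ge_max tentL/=.
rewrite -opprD normrN (le_trans _ (ler_coord_enorm _ i))//.
by rewrite !mxE.
Qed.

Lemma clipped_coord_neq0 r i y : clipped_coord r i y != 0 -> `|y| <= r.
Proof.
move=> cy; apply: tent_neq0; apply: contra cy => /eqP; rewrite /clipped_coord => ->.
by apply/eqP; rewrite oppr0; apply/max_idPl; rewrite oppr_le0 le_max lexx.
Qed.

Lemma Lip0_clipped_coord r i : Lip0 (clipped_coord r i).
Proof.
exact: bounded_support_Lip0 (@elipschitz_clipped_coord r i)
  (@clipped_coord_neq0 r i).
Qed.

(** Within half the radius of its support the tent is at least [|y|], so that
    the clipping is not active there. *)
Lemma clipped_coordE r i y : 2 * `|y| <= r -> clipped_coord r i y = y ord0 i.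
Proof.
have := ler_coord_norm y i; have := le_tent r y.
rewrite /clipped_coord; move: (tent r y) => t rt; rewrite ler_norml => /andP[y1 y2] yr.
have -> : Num.max (- t) (- y ord0 i) = - y ord0 i by apply/max_idPr; lra.
by rewrite opprK; apply/max_idPr; lra.
Qed.

(** Without an admissible cutoff the choice in [riesz_pairing1] would default to
    the zero function. A high tent truncated at 1 is an admissible cutoff. *)
Lemma cutoffs_neq0 f : Lip0 f -> exists psi, cutoffs f psi.
Proof.
move=> lf; have [r r0 fr] := Lip0_support_bounded lf.
pose psi y := - Num.max (- 1) (- tent (r + 2) y).
have psiE y : `|y| < r + 1 -> psi y = 1.
  move=> yr; have := le_tent (r + 2) y; rewrite /psi => ht.
  by have -> : Num.max (- 1) (- tent (r + 2) y) = - 1; [apply/max_idPl; lra|lra].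
exists psi; split.
  apply: (@bounded_support_Lip0 1 (r + 2)) => [x y|y].
    rewrite -opprD normrN (le_trans (ler_dist_max _ _ _ _))//.
    rewrite subrr normr0 ge_max mulr_ge0 ?enorm_ge0//=.
    by rewrite -opprD normrN; exact: elipschitz_tent.
  move=> psi0; apply: tent_neq0; apply: contra psi0 => /eqP.
  by rewrite /psi => ->; apply/eqP; rewrite oppr0 (max_idPr _) ?oppr0//; lra.
move=> x /fr xr; have : open [set y : 'rV[R]_d | `|y| < r + 1].
  apply: (@open_comp _ _ (fun y : 'rV[R]_d => `|y|) [set t | t < r + 1]).
    by move=> y _; exact: norm_continuous.
  exact: open_lt.
move=> oU; apply: (filterS psiE); apply: open_nbhs_nbhs; split => //=.
by rewrite (le_lt_trans xr)// ltrDl.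
Qed.

End lipschitz_functions.

(** * The kernel *)

Section kernel.
Variables (R : realType) (d : nat) (s : R).
Implicit Types (z : 'rV[R]_d) (i : 'I_d).

Lemma riesz_kernelE z i :
  riesz_kernel s z ord0 i = (enorm z `^ (s + 1))^-1 * z ord0 i.
Proof. by rewrite mxE. Qed.

Lemma riesz_kernelN z i :
  riesz_kernel s (- z) ord0 i = - riesz_kernel s z ord0 i.
Proof. by rewrite !riesz_kernelE enormN mxE mulrN. Qed.

(** The gain of one power of [|z|] that makes every integral below converge:
    a weight that vanishes linearly on the diagonal turns the kernel, of size
    [|z|^-s], into something dominated by the energy density. *)
Lemma riesz_kernel_bound z i :
  enorm z * `|riesz_kernel s z ord0 i| <= enorm z `^ (- (s - 1)).
Proof.
have [e0|e0] := eqVneq (enorm z) 0; first by rewrite e0 mul0r powR_ge0.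
rewrite riesz_kernelE normrM -powRN ger0_norm ?powR_ge0//.
apply: (@le_trans _ _ (enorm z * (enorm z `^ (- (s + 1)) * enorm z))).
  by rewrite ler_wpM2l ?enorm_ge0// ler_wpM2l ?powR_ge0// ler_coord_enorm.
rewrite -[X in X * (_ * X)](powRr1 (enorm_ge0 z)) -!powRD ?e0 ?implybT//.
by rewrite (_ : _ + _ = - (s - 1))//; ring.
Qed.

Lemma riesz_kernel_dot z :
  \sum_(i < d) z ord0 i * riesz_kernel s z ord0 i =
  (enorm z `^ (s + 1))^-1 * enorm z ^+ 2.
Proof.
rewrite sqr_enorm mulr_sumr; apply: eq_bigr => i _.
by rewrite riesz_kernelE expr2 mulrCA.
Qed.

Lemma riesz_kernel_dot_ge0 z :
  0 <= \sum_(i < d) z ord0 i * riesz_kernel s z ord0 i.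
Proof.
by rewrite riesz_kernel_dot mulr_ge0 ?invr_ge0 ?powR_ge0 ?sqr_ge0.
Qed.

Lemma riesz_kernel_dot_eq0 z :
  \sum_(i < d) z ord0 i * riesz_kernel s z ord0 i = 0 -> z = 0.
Proof.
rewrite riesz_kernel_dot => /eqP.
rewrite mulf_eq0 invr_eq0 powR_eq0 sqrf_eq0 enorm_eq0.
by move=> /orP[/andP[/eqP]|/eqP].
Qed.

End kernel.

(** * Measurability and integrals *)

Section measurability.
Variables (R : realType) (d : nat).
Implicit Types (i : 'I_d) (f : 'rV[R]_d -> R).
Let T := ('rV[R]_d * 'rV[R]_d)%type.

Lemma open_measurable_rV (A : set 'rV[R]_d) : open A -> measurable A.
Proof. by move=> oA; apply: sub_sigma_algebra. Qed.

Lemma closed_measurable_rV (A : set 'rV[R]_d) : closed A -> measurable A.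
Proof.
move=> cA; rewrite -[A]setCK; apply: measurableC.
by apply: open_measurable_rV; exact: closed_openC.
Qed.

Lemma measurable_set1_rV (x : 'rV[R]_d) : measurable [set x].
Proof.
apply: closed_measurable_rV; apply: accessible_closed_set1.
by apply: hausdorff_accessible; exact: norm_hausdorff.
Qed.

Lemma continuous_measurable_rV f : continuous f -> measurable_fun setT f.
Proof.
move=> /continuousP cf; apply: (measurability _ (RGenOpens.measurableE R)).
move=> _ [_ [a [b ->] <-]]; rewrite setTI.
by apply: open_measurable_rV; exact/cf/interval_open.
Qed.

Lemma measurable_fun_fst f : measurable_fun setT f ->
  measurable_fun setT (fun z : T => f z.1).
Proof. by move=> mf; exact: (measurableT_comp mf measurable_fst). Qed.

Lemma measurable_fun_snd f : measurable_fun setT f ->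
  measurable_fun setT (fun z : T => f z.2).
Proof. by move=> mf; exact: (measurableT_comp mf measurable_snd). Qed.

Lemma measurable_diff_coord i :
  measurable_fun setT (fun z : T => (z.1 - z.2) ord0 i).
Proof.
have mc : measurable_fun setT (fun y : 'rV[R]_d => y ord0 i).
  by apply: continuous_measurable_rV => x; exact: coord_continuous.
rewrite (_ : (fun z => _) = (fun z : T => z.1 ord0 i - z.2 ord0 i)).
  apply: measurable_funB; first exact: (measurable_fun_fst mc).
  exact: (measurable_fun_snd mc).
by apply/funext => z; rewrite !mxE.
Qed.

Lemma measurable_enorm_diff_powR (a : R) :
  measurable_fun setT (fun z : T => enorm (z.1 - z.2) `^ a).
Proof.
apply: (measurableT_comp (measurable_powR a)).
rewrite (_ : (fun z => _) =
  (fun z : T => (\sum_(i < d) (z.1 - z.2) ord0 i ^+ 2) `^ 2^-1)).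
  apply: (measurableT_comp (measurable_powR _)); apply: measurable_sum => i.
  by apply: measurable_funX; exact: measurable_diff_coord.
by apply/funext => z; rewrite powR12_sqrt// sumr_ge0// => i _; exact: sqr_ge0.
Qed.

Lemma measurable_riesz_kernel (s : R) i :
  measurable_fun setT (fun z : T => riesz_kernel s (z.1 - z.2) ord0 i).
Proof.
under eq_fun do rewrite riesz_kernelE -powRN.
by apply: measurable_funM;
  [exact: measurable_enorm_diff_powR|exact: measurable_diff_coord].
Qed.

End measurability.

Section null_measure.
Import HBNNSimple.
Local Open Scope ereal_scope.
Context dT (T : measurableType dT) (R : realType).

(** Stated for a mere set function and an arbitrary domain, so as to cover a
    product of null measures and compact subsets of a product, for which neither
    a measure structure nor measurability is at hand. *)
Lemma null_integral (m : set T -> \bar R) (D : set T) (f : T -> \bar R) :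
  (forall A, measurable A -> m A = 0) -> \int[m]_(x in D) f x = 0.
Proof.
move=> m0; have sup0 (g : T -> \bar R) : (forall x, 0 <= g x) ->
    ereal_sup [set sintegral m h |
      h in [set h : {nnsfun T >-> R} | forall x,
        (h x)%:E <= g x]] = 0.
  move=> g0; rewrite -[RHS](ereal_sup1 0); congr ereal_sup.
  have s0 (h : {nnsfun T >-> R}) :
      sintegral m h = 0.
    by rewrite sintegralET fsbig1// => r _; rewrite m0 ?mule0//.
  apply/seteqP; split => [_ [h _ <-]|_ ->]; first by rewrite /= s0.
  exists (nnsfun0 : {nnsfun T >-> R}); last exact: s0.
  by move=> x; exact: g0.
rewrite /integral !sup0 ?sube0//.
Qed.

End null_measure.

Section locally_finite.
Variables (R : realType) (d : nat) (mu : {measure set 'rV[R]_d -> \bar R}).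

Lemma measurable_norm_ball (r : R) : measurable [set y : 'rV[R]_d | `|y| <= r].
Proof. by apply: closed_measurable_rV; exact: closed_norm_ball. Qed.

Lemma bigcup_norm_ball :
  [set: 'rV[R]_d] = \bigcup_n [set y : 'rV[R]_d | `|y| <= n%:R].
Proof.
apply/seteqP; split => // y _; exists (Num.bound `|y|) => //=.
by apply/ltW/archi_boundP.
Qed.

(** By compactness, a ball is covered by finitely many of the open sets of finite
    measure that local finiteness provides. *)
Lemma locally_finite_norm_ball (r : R) :
  locally_finite mu -> (mu [set y : 'rV[R]_d | (`|y| <= r)%R] < +oo)%E.
Proof.
move=> lf; pose U x : set 'rV[R]_d := s2val (cid2 (lf x)).
have oU x : open (U x) by rewrite /U; case: cid2 => V /= [].
have Ux x : U x x by rewrite /U; case: cid2 => V /= [].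
have Uoo x : (mu (U x) < +oo)%E by rewrite /U; case: cid2.
have := @compact_norm_ball R d r; rewrite compact_cover.
move=> /(_ _ setT U (fun x _ => oU x)) [|F _ rF]; first by move=> x _; exists x.
have finF := finite_fset F.
have le_sum := @content_sub_fsum _ _ _ mu _ _ _ _ finF
  (fun x _ => open_measurable_rV (oU x)) (measurable_norm_ball r) rF.
apply: (le_lt_trans le_sum).
rewrite fsbig_finite//=.
by apply: lte_sum_pinfty => x _; exact: Uoo.
Qed.

Lemma locally_finite_sigma_finite :
  locally_finite mu -> sigma_finite [set: 'rV[R]_d] mu.
Proof.
move=> lf; exists (fun n => [set y : 'rV[R]_d | `|y| <= n%:R]).
  exact: bigcup_norm_ball.
by move=> n; split; [exact: measurable_norm_ball|exact: locally_finite_norm_ball].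
Qed.

Lemma Lip0_integrable (f : 'rV[R]_d -> R) :
  locally_finite mu -> Lip0 f -> mu.-integrable setT (EFin \o f).
Proof.
move=> lf cf; have [M M0 fM] := Lip0_bounded cf.
have [r _ fr] := Lip0_support_bounded cf.
pose B := [set y : 'rV[R]_d | `|y| <= r].
have mB : measurable B := measurable_norm_ball r.
apply: (@le_integrable _ _ _ mu _ measurableT _ (fun y => (M * \1_B y)%:E)).
- apply/measurable_EFinP; apply: continuous_measurable_rV.
  exact: Lip0_continuous.
- move=> y _ /=; rewrite lee_fin (ger0_norm (mulr_ge0 _ _))//.
  have [->|fy0] := eqVneq (f y) 0; first by rewrite normr0 mulr_ge0.
  rewrite indicE mem_set ?mulr1//=.
  by apply: fr; exact: support_subset_closed.
- under eq_fun do rewrite EFinM; apply: integrableZl => //.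
  apply/integrableP; split; first exact/measurable_EFinP/measurable_indic.
  under eq_integral do rewrite gee0_abs ?lee_fin//.
  by rewrite integral_indic// setIT; exact: locally_finite_norm_ball.
Qed.

End locally_finite.

Section Rintegral_complements.
Context dT (T : measurableType dT) (R : realType).

(** As a real-valued integral is [0] when the function is not integrable, and
    multiplication by a nonzero constant preserves non-integrability,
    homogeneity holds unconditionally. This spares a discussion of the points
    where the integral defining the transform of [f mu] converges. *)
Lemma RintegralZl_total (m : {measure set T -> \bar R}) (c : R) (h : T -> R) :
  measurable_fun setT h ->
  \int[m]_x (c * h x) = c * \int[m]_x h x.
Proof.
move=> mh; have [->|c0] := eqVneq c 0.
  rewrite mul0r /Rintegral; under eq_integral do rewrite mul0r.
  by rewrite integral0.
have [ih|nih] := pselect (m.-integrable setT (EFin \o h)).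
  exact: RintegralZl.
have not_fin g : measurable_fun setT g -> ~ m.-integrable setT (EFin \o g) ->
    \int[m]_x g x = 0.
  move=> mg nig; rewrite /Rintegral.
  suff : (\int[m]_x (g x)%:E \isn't a fin_num)%E.
    by case: integral.
  apply/negP => gfin; apply: nig.
  apply/integrableP; split; first exact/measurable_EFinP.
  move: gfin; rewrite integralE fin_numB => /andP[pfin nfin].
  have mE : measurable_fun setT (EFin \o g) by exact/measurable_EFinP.
  have -> : (\int[m]_x `|(EFin \o g) x| =
      \int[m]_x ((EFin \o g)^\+ x + (EFin \o g)^\- x))%E.
    by rewrite -[X in integral _ _ X]/(abse \o (EFin \o g)) fune_abse.
  rewrite ge0_integralD//; [|exact: measurable_funepos|exact: measurable_funeneg].
  by rewrite ltey_eq fin_numD pfin nfin.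
rewrite !not_fin ?mulr0//; first exact: measurable_funM.
move=> ich; apply: nih.
rewrite (_ : EFin \o h = fun x => (c^-1%:E * (EFin \o (fun x => c * h x)%R) x)%E).
  exact: integrableZl.
by apply/funext => x /=; rewrite -EFinM mulKf.
Qed.

Lemma Rintegral_swap (m : {sigma_finite_measure set T -> \bar R})
    (F : T * T -> R) :
  (m \x m)%E.-integrable setT (EFin \o F) ->
  (m \x m)%E.-integrable setT (fun z => (F (z.2, z.1))%:E) ->
  \int[(m \x m)%E]_z F (z.2, z.1) = \int[(m \x m)%E]_z F z.
Proof.
move=> iF iFs; congr fine.
by rewrite -(integral12_prod_meas1 iFs) -(integral21_prod_meas1 iF).
Qed.

End Rintegral_complements.

(** * The antisymmetric form of the pairing with 1 *)

Section antisymmetric_form.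
Variables (R : realType) (d : nat) (s : R).
Variable mu : {sigma_finite_measure set 'rV[R]_d -> \bar R}.
Hypothesis lfmu : locally_finite mu.
Let T := ('rV[R]_d * 'rV[R]_d)%type.
Let P : {measure set T -> \bar R} := (mu \x mu)%E.
Let K (i : 'I_d) (z : T) : R := riesz_kernel s (z.1 - z.2) ord0 i.
Let dist (z : T) : R := enorm (z.1 - z.2).
Implicit Types (f g : 'rV[R]_d -> R) (i : 'I_d) (k : T -> R).

Hypothesis finite_energy : (\int[P]_z energy_density s z < +oo)%E.

Lemma energy_integrable : P.-integrable setT (energy_density s).
Proof.
apply/integrableP; split.
  by apply/measurable_EFinP; exact: measurable_enorm_diff_powR.
by under eq_integral do rewrite gee0_abs ?lee_fin ?powR_ge0//.
Qed.

Let energy : R := \int[P]_z (dist z `^ (- (s - 1))).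

Lemma weight_bound k (C : R) i z : 0 <= C -> `|k z| <= C * dist z ->
  `|k z * K i z| <= C * dist z `^ (- (s - 1)).
Proof.
move=> C0 kC; rewrite normrM (le_trans (ler_wpM2r _ kC))// -mulrA.
by rewrite ler_wpM2l// riesz_kernel_bound.
Qed.

Lemma integrable_weight k (C : R) i : 0 <= C ->
  measurable_fun setT k -> (forall z, `|k z| <= C * dist z) ->
  P.-integrable setT (fun z => (k z * K i z)%:E).
Proof.
move=> C0 mk kC; apply: (le_integrable _ _ _ (integrableZl _ C energy_integrable)) => //.
  apply/measurable_EFinP; apply: measurable_funM => //.
  exact: measurable_riesz_kernel.
move=> z _ /=; rewrite lee_fin [leRHS]ger0_norm ?mulr_ge0 ?powR_ge0//.
exact: weight_bound.
Qed.

Lemma Rintegral_weight_bound k (C : R) i : 0 <= C ->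
  measurable_fun setT k -> (forall z, `|k z| <= C * dist z) ->
  `|\int[P]_z (k z * K i z)| <= C * energy.
Proof.
move=> C0 mk kC; have ik := integrable_weight i C0 mk kC.
rewrite (le_trans (le_normr_Rintegral _ _))// /energy -RintegralZl//; last first.
  exact: energy_integrable.
apply: le_Rintegral => //.
- by have := integrable_norm ik.
- by have := integrableZl measurableT C energy_integrable.
- by move=> z _; exact: weight_bound.
Qed.

(** The pairing of [R(f mu)] with [1], written as for
    [riesz_pairing] with the constant function [1] in the place of [phi]. *)
Definition riesz_form i f : R :=
  \int[P]_z (2^-1 * (f z.2 - f z.1) * K i z).

Lemma measurable_Lip0 f : Lip0 f -> measurable_fun setT f.
Proof. by move=> /Lip0_continuous; exact: continuous_measurable_rV. Qed.

Lemma measurable_half_diff f : measurable_fun setT f ->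
  measurable_fun setT (fun z : T => 2^-1 * (f z.2 - f z.1)).
Proof.
move=> mf; apply: measurable_funM => //; apply: measurable_funB.
  exact: measurable_fun_snd.
exact: measurable_fun_fst.
Qed.

Lemma half_diff_bound L f (z : T) : elipschitz L f ->
  `|2^-1 * (f z.2 - f z.1)| <= 2^-1 * L * dist z.
Proof.
move=> fL; rewrite normrM ger0_norm// -mulrA ler_wpM2l// distrC.
exact: fL.
Qed.

Lemma integrable_half_diff i f : Lip0 f ->
  P.-integrable setT (fun z => (2^-1 * (f z.2 - f z.1) * K i z)%:E).
Proof.
move=> lf; have [L L0 fL] := Lip0_elipschitz lf.
apply: (@integrable_weight _ (2^-1 * L)).
- by rewrite mulr_ge0.
- by apply: measurable_half_diff; exact: measurable_Lip0.
- by move=> z; exact: half_diff_bound.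
Qed.

(** Only the Lipschitz constant of [f] enters, not its size. *)
Lemma riesz_form_bound i L f : 0 <= L -> elipschitz L f ->
  `|riesz_form i f| <= 2^-1 * L * energy.
Proof.
move=> L0 fL; apply: Rintegral_weight_bound.
- by rewrite mulr_ge0.
- apply: measurable_half_diff; apply: continuous_measurable_rV.
  exact: elipschitz_continuous fL.
- by move=> z; exact: half_diff_bound.
Qed.

Lemma riesz_form_sub i (a : R) f g : Lip0 f -> Lip0 g ->
  riesz_form i (fun x => f x - a * g x) = riesz_form i f - a * riesz_form i g.
Proof.
move=> lf lg; rewrite /riesz_form -RintegralZl//; last exact: integrable_half_diff.
rewrite -RintegralB//; last 2 first.
- exact: integrable_half_diff.
- exact: (integrableZl measurableT a (integrable_half_diff i lg)).
by apply: eq_Rintegral => z _; ring.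
Qed.

(** The cutoff disappears: on the one hand the two parts of the pairing add
    up, after averaging the second with its image under the exchange of the
    variables, to the integrand of [riesz_form]; on the other hand
    [f y * (1 - psi x) = f y * (psi y - psi x)] vanishes linearly on the
    diagonal, so that both parts converge absolutely. *)
Lemma riesz_pairing1E i f : Lip0 f ->
  riesz_pairing1 s mu f ord0 i = riesz_form i f.
Proof.
move=> lf; rewrite /riesz_pairing1.
set psi := xget _ _.
have [lpsi psi_near] : cutoffs f psi by apply: xgetPex; exact: cutoffs_neq0.
have psi1 x : f x != 0 -> psi x = 1.
  by move=> /support_subset_closed/psi_near/nbhs_singleton.
have [Lf Lf0 fL] := Lip0_elipschitz lf.
have [Lp Lp0 pL] := Lip0_elipschitz lpsi.
have [Mf Mf0 fM] := Lip0_bounded lf.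
have [Mp Mp0 pM] := Lip0_bounded lpsi.
have mf := measurable_Lip0 lf; have mp := measurable_Lip0 lpsi.
have m1 := @measurable_fun_fst R d; have m2 := @measurable_fun_snd R d.
pose k0 (z : T) := 2^-1 * (f z.2 * psi z.1 - psi z.2 * f z.1).
pose k1 (z : T) := f z.2 * (1 - psi z.1).
have mk0 : measurable_fun setT k0.
  apply: measurable_funM => //; apply: measurable_funB; apply: measurable_funM.
  - exact: (m2 _ mf).
  - exact: (m1 _ mp).
  - exact: (m2 _ mp).
  - exact: (m1 _ mf).
have mk1 : measurable_fun setT k1.
  apply: measurable_funM; first exact: (m2 _ mf).
  by apply: measurable_funB => //; exact: (m1 _ mp).
have b0 z : `|k0 z| <= (Mf * Lp + Mp * Lf) * dist z.
  rewrite /k0 normrM ger0_norm//.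
  have -> : f z.2 * psi z.1 - psi z.2 * f z.1 =
    f z.2 * (psi z.1 - psi z.2) - psi z.2 * (f z.1 - f z.2) by ring.
  have half_le (t : R) : 0 <= t -> 2^-1 * t <= t by lra.
  rewrite (le_trans (half_le _ _))// (le_trans (ler_normB _ _))//.
  rewrite mulrDl; apply: lerD; rewrite normrM -mulrA; exact: ler_pM.
have b1 z : `|k1 z| <= Mf * Lp * dist z.
  rewrite /k1; have [->|fz] := eqVneq (f z.2) 0.
    by rewrite mul0r normr0 !mulr_ge0// enorm_ge0.
  rewrite -(psi1 _ fz) normrM -mulrA; apply: ler_pM => //.
  by rewrite distrC.
pose k1s (z : T) := - (f z.1 * (1 - psi z.2)).
have i0 : P.-integrable setT (fun z => (k0 z * K i z)%:E).
  by apply: integrable_weight mk0 b0; rewrite addr_ge0// mulr_ge0.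
have i1 : P.-integrable setT (fun z => (k1 z * K i z)%:E).
  by apply: integrable_weight mk1 b1; rewrite mulr_ge0.
have swapE z : k1 (z.2, z.1) * K i (z.2, z.1) = k1s z * K i z.
  by rewrite /k1s /K /= -opprB riesz_kernelN mulrN mulNr.
have i1s : P.-integrable setT (fun z => (k1s z * K i z)%:E).
  apply: (@integrable_weight _ (Mf * Lp)); first by rewrite mulr_ge0.
    have -> : k1s = (fun z => - (k1 (z.2, z.1))) by [].
    apply: measurable_funN; exact: (measurableT_comp mk1 (@measurable_swap _ _ _ _)).
  move=> z; rewrite normrN (le_trans (b1 (z.2, z.1)))// /dist /=.
  by rewrite -opprB enormN.
have int1s : \int[P]_z (k1s z * K i z) = \int[P]_z (k1 z * K i z).
  have := Rintegral_swap (F := fun z => k1 z * K i z) i1.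
  under eq_fun do rewrite swapE.
  by move=> /(_ i1s) <-; apply: eq_Rintegral => z _; rewrite swapE.
have far : vintegral mu (fun x => (1 - psi x) *: riesz_transform s mu f x) ord0 i
    = \int[P]_z (k1 z * K i z).
  have iF := integrable_fubini_F i1.
  rewrite mxE [RHS]/Rintegral -(integral12_prod_meas1 i1).
  transitivity (fine (\int[mu]_x
      (fine (fubini_F mu (fun z => (k1 z * K i z)%:E) x))%:E)%E).
    congr fine; apply: eq_integral => x _; congr EFin.
    rewrite mxE /riesz_transform mxE -[fine _]/(\int[mu]_y _) -RintegralZl_total.
      by apply: eq_Rintegral => y _; rewrite mxE /k1 /K /= mulrCA mulrA.
    under eq_fun do rewrite mxE.
    apply: measurable_funM => //.
    exact: (measurable_fun_pair2 x (measurable_riesz_kernel s i)).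
  congr fine; apply: ae_eq_integral => //.
  - apply/measurable_EFinP.
    apply: (measurableT_comp (fine_measurable _) (measurable_fubini_F i1)).
    exact: measurableT.
  - exact: measurable_fubini_F i1.
  - by apply: filterS (integrable_ae measurableT iF) => x /= + _ => /(_ I)/fineK.
rewrite mxE far /riesz_pairing mxE.
transitivity (\int[P]_z (k0 z * K i z) + \int[P]_z (k1 z * K i z)).
  congr (_ + _); rewrite [RHS]/Rintegral; congr fine.
  by apply: eq_integral => z _; rewrite mxE.
transitivity (\int[P]_z (k0 z * K i z) +
   (2^-1 * \int[P]_z (k1 z * K i z) + 2^-1 * \int[P]_z (k1s z * K i z))).
  by rewrite int1s; congr (_ + _); move: (Rintegral _ _ _) => A; lra.
rewrite -!RintegralZl//.
have iZ k : P.-integrable setT (fun z => (k z * K i z)%:E) ->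
    P.-integrable setT (fun z => (2^-1 * (k z * K i z))%:E).
  by move=> ik; exact: (integrableZl measurableT 2^-1 ik).
rewrite -RintegralD//; [|exact: (iZ _ i1)|exact: (iZ _ i1s)].
rewrite -RintegralD//; last exact: (integrableD measurableT (iZ _ i1) (iZ _ i1s)).
by apply: eq_Rintegral => z _; rewrite /k0 /k1 /k1s; ring.
Qed.

(** * Reflectionless measures of finite energy *)

Hypothesis no_atom : forall x, mu [set x] = 0%E.
Hypothesis orthogonal_to_1 :
  forall f, Lip0 f -> \int[mu]_x f x = 0 -> riesz_pairing1 s mu f = 0.

(** On the ball of radius [r] the tent of height [r + c] is at least [c]. *)
Lemma tent_mass (r c : R) : 0 <= c ->
  c * fine (mu [set y : 'rV[R]_d | `|y| <= r]) <= \int[mu]_x tent (r + c) x.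
Proof.
move=> c0; set B := [set _ | _]; have mB : measurable B := measurable_norm_ball r.
have muB : mu B \is a fin_num.
  by rewrite ge0_fin_numE//; exact: locally_finite_norm_ball.
have it := Lip0_integrable lfmu (Lip0_tent d (r + c)).
have mt : measurable_fun setT (EFin \o tent (d := d) (r + c)).
  by apply/measurable_EFinP; apply: measurable_Lip0; exact: Lip0_tent.
rewrite -lee_fin EFinM fineK// /Rintegral fineK; last exact: integrable_fin_num.
rewrite -integral_cst//.
apply: (@le_trans _ _ (\int[mu]_(x in B) (tent (r + c) x)%:E)%E).
  apply: ge0_le_integral => //.
  - exact: measurable_funTS.
  - move=> x /= Bx; rewrite lee_fin (le_trans _ (le_tent _ _))//.
    by rewrite addrAC lerDr subr_ge0.
apply: ge0_subset_integral => //.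
by move=> x _; rewrite lee_fin tent_ge0.
Qed.

(** Orthogonality to [1] on functions of mean zero makes [riesz_form i] a
    multiple [c] of the integral on all of [Lip0]. Tents of increasing height
    have integrals tending to infinity, while their forms stay bounded because
    they are all 1-Lipschitz; hence [c = 0]. *)
Lemma riesz_form_eq0 i f : mu setT != 0%E -> Lip0 f -> riesz_form i f = 0.
Proof.
move=> mu0 lf.
have [r mr] : exists r : R, 0 < fine (mu [set y : 'rV[R]_d | `|y| <= r]).
  apply: contrapT => /forallNP small; move: mu0; apply/negP; rewrite negbK.
  apply/eqP; apply: measure_negligible => //; rewrite bigcup_norm_ball.
  apply: negligible_bigcup => n; apply/negligibleP; first exact: measurable_norm_ball.
  apply/eqP; rewrite -fine_eq0; last first.
    by rewrite ge0_fin_numE//; exact: locally_finite_norm_ball.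
  by have /negP := small n%:R; rewrite lt0r fine_ge0// andbT negbK.
move: mr; set m := fine _ => m0.
set b := \int[mu]_x f x.
(* [t] corrects [f] to mean zero; [n.+1], and not [n], ensures that its
   integral [a] is nonzero. *)
have key (n : nat) : `|riesz_form i f| * (n.+1%:R * m) <= `|b| * (2^-1 * energy).
  pose t := tent (d := d) (r + n.+1%:R).
  have lt : Lip0 t by exact: Lip0_tent.
  set a := \int[mu]_x t x.
  have ma : n.+1%:R * m <= a by apply: tent_mass.
  have a0 : 0 < a by rewrite (lt_le_trans _ ma)// mulr_gt0.
  have g0 : \int[mu]_x (f x - b / a * t x) = 0.
    rewrite RintegralB//; last 2 first.
    - exact: Lip0_integrable.
    - exact: (integrableZl measurableT (b / a) (Lip0_integrable lfmu lt)).
    rewrite RintegralZl//; last exact: (Lip0_integrable lfmu lt).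
    by rewrite -/a -/b divfK ?subrr// gt_eqF.
  have := riesz_pairing1E i (Lip0_sub (b / a) lf lt).
  rewrite (orthogonal_to_1 (Lip0_sub _ lf lt) g0) mxE riesz_form_sub//.
  move=> /esym/eqP; rewrite subr_eq0 => /eqP formE.
  apply: (@le_trans _ _ (`|riesz_form i f| * a)); first by rewrite ler_wpM2l.
  rewrite formE !normrM normfV (gtr0_norm a0) -[`|b| / a * _ * a]mulrA.
  rewrite [_ * a]mulrC mulrA divfK ?gt_eqF// ler_wpM2l//.
  rewrite -[2^-1]mulr1; apply: riesz_form_bound => //.
  exact: elipschitz_tent.
apply/eqP; apply/negPn/negP => F0.
pose c := `|riesz_form i f| * m.
have c0 : 0 < c by rewrite mulr_gt0 ?normr_gt0.
have rhs0 : 0 <= `|b| * (2^-1 * energy).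
  by rewrite (le_trans _ (key 0))// !mulr_ge0// ltW.
have := archi_boundP (divr_ge0 rhs0 (ltW c0)).
rewrite ltr_pdivrMr// ltNge => /negP; apply.
rewrite (le_trans _ (key (Num.bound (`|b| * (2^-1 * energy) / c))))//.
by rewrite [leRHS]mulrCA -/c; apply: ler_wpM2r; rewrite ?ltW// ltr_nat.
Qed.

(** The form of the [i]-th coordinate, reached as a limit of the clipped
    coordinates: these are uniformly 1-Lipschitz, hence dominated by the energy
    density, and at each point they are eventually equal to the coordinate. *)
Lemma coordinate_form_eq0 i : mu setT != 0%E ->
  P.-integrable setT (fun z => ((z.1 - z.2) ord0 i * K i z)%:E) /\
  (\int[P]_z ((z.1 - z.2) ord0 i * K i z)%:E = 0)%E.
Proof.
move=> mu0.
pose D (z : T) := ((z.1 - z.2) ord0 i * K i z)%:E.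
pose F (n : nat) (z : T) := (2^-1 *
  (clipped_coord n%:R i z.2 - clipped_coord n%:R i z.1) * K i z)%:E.
have lc (n : nat) : Lip0 (clipped_coord (n%:R : R) i).
  exact: Lip0_clipped_coord.
have mD : measurable_fun setT D.
  apply/measurable_EFinP; apply: measurable_funM; first exact: measurable_diff_coord.
  exact: measurable_riesz_kernel.
(* The factor [- 1/2] is that of the form, where [f z.2] comes first. *)
pose D' z := ((- 2^-1)%:E * D z)%E.
have [iD' _ cF] : [/\ P.-integrable setT D',
   [sequence \int[P]_z (`|F n z - D' z|)]_n @ \oo --> 0%E &
   [sequence \int[P]_z (F n z)]_n @ \oo --> (\int[P]_z D' z)]%E.
  apply: (@dominated_convergence _ _ _ P _ measurableT F D'
    (fun z => (2^-1)%:E * energy_density s z)%E).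
  - move=> n; apply/measurable_EFinP; apply: measurable_funM.
      by apply: measurable_half_diff; exact: measurable_Lip0.
    exact: measurable_riesz_kernel.
  - exact: measurable_funeM.
  - apply: aeW => z _; apply: cvg_near_cst; near=> n.
    have z1 : 2 * `|z.1| <= n%:R by near: n; exact: nbhs_infty_ger.
    have z2 : 2 * `|z.2| <= n%:R by near: n; exact: nbhs_infty_ger.
    rewrite /F /D' /D !clipped_coordE// -EFinM; congr EFin.
    by rewrite !mxE; ring.
  - exact: (integrableZl measurableT 2^-1 energy_integrable).
  - apply: aeW => z n _; rewrite lee_fin.
    apply: (@weight_bound (fun z : T => 2^-1 *
      (clipped_coord n%:R i z.2 - clipped_coord n%:R i z.1))) => //.
    rewrite -[2^-1 in leRHS]mulr1; apply: half_diff_bound.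
    exact: elipschitz_clipped_coord.
have F0 n : (\int[P]_z F n z = 0)%E.
  rewrite -[LHS]fineK; last first.
    by apply: integrable_fin_num => //; exact: integrable_half_diff.
  by congr EFin; exact: riesz_form_eq0.
have int0 : (\int[P]_z D' z = 0)%E.
  apply/esym; apply: cvg_unique cF => //.
  by rewrite (_ : (fun n => _) = cst 0%E); [exact: cvg_cst|apply/funext].
have DE : D = (fun z => (- 2)%:E * D' z)%E.
  apply/funext => z; rewrite /D' /D -!EFinM; congr EFin.
  by rewrite mulrA -[LHS]mul1r; congr (_ * _); field.
split; rewrite -/D DE; first exact: integrableZl.
by rewrite integralZl// int0 mule0.
Unshelve. all: by end_near. Qed.

Lemma off_diagonal_mass :
  P [set z : T | z.1 != z.2] = (mu setT * mu setT)%E.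
Proof.
rewrite -integral_cst//; apply: eq_integral => x _ /=.
have mx := measurable_set1_rV x.
transitivity (mu (~` [set x])).
  congr (mu _); apply/seteqP; split => y; rewrite /xsection /= inE /=.
    by move=> /eqP xy yx; apply: xy.
  by move=> yx; apply/eqP => xy; apply: yx.
transitivity (mu [set x] + mu (~` [set x]))%E; first by rewrite no_atom add0e.
rewrite -measureU ?setICr ?setUv//; exact: measurableC.
Qed.

(** Testing the form on the coordinates and summing gives that the integral of
    [x . K(x)], which is the energy density off the diagonal, is zero. As that
    density is positive off the diagonal, the diagonal carries all of
    [mu \x mu]; but it is null. *)
Lemma reflectionless_null : mu setT = 0%E.
Proof.
apply/eqP; apply/negPn/negP => mu0.
pose D (z : T) := \sum_(i < d) (z.1 - z.2) ord0 i * K i z.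
have mD : measurable_fun setT D.
  apply: measurable_sum => i; apply: measurable_funM.
    exact: measurable_diff_coord.
  exact: measurable_riesz_kernel.
have intD : (\int[P]_z (D z)%:E = 0)%E.
  under eq_integral do rewrite /D -sumEFin.
  rewrite integral_sum//; last by move=> i; exact: (coordinate_form_eq0 i mu0).1.
  by rewrite big1// => i _; exact: (coordinate_form_eq0 i mu0).2.
have /(ae_eq_integral_abs P measurableT (f := EFin \o D)) D0 :
    (\int[P]_z `|(D z)%:E| = 0)%E.
  rewrite -[RHS]intD; apply: eq_integral => z _.
  by rewrite gee0_abs// lee_fin riesz_kernel_dot_ge0.
have offE : [set z : T | z.1 != z.2] = D @^-1` (~` [set 0]).
  apply/seteqP; split => z /=; first move=> /eqP z12 /riesz_kernel_dot_eq0/eqP.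
    by rewrite subr_eq0 => /eqP.
  move=> Dz; apply/eqP => z12; apply: Dz; rewrite /D z12 subrr big1// => i _.
  by rewrite mxE mul0r.
have : P [set z : T | z.1 != z.2] = 0%E.
  apply: measure_negligible.
    rewrite offE -[X in measurable X]setTI; apply: mD => //.
    exact: measurableC.
  rewrite offE; have /D0 : measurable_fun setT (EFin \o D) by exact/measurable_EFinP.
  apply: negligibleS => z /= Dz DzE; apply: Dz.
  by have [] := DzE I.
by rewrite off_diagonal_mass => /eqP; rewrite mule_eq0 orbb (negbTE mu0).
Qed.

End antisymmetric_form.

(** * The zero measure is reflectionless *)

Section null_reflectionless.
Variables (R : realType) (d : nat) (s : R).
Variable mu : {measure set 'rV[R]_d -> \bar R}.
Hypothesis mu0 : forall A : set 'rV[R]_d, measurable A -> mu A = 0%E.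
Let P := (mu \x mu)%E.

Let P0 (A : set ('rV[R]_d * 'rV[R]_d)) : measurable A -> P A = 0%E.
Proof. by move=> _; exact: null_integral. Qed.

Let null_vintegral (F : 'rV[R]_d -> 'rV[R]_d) : vintegral mu F = 0.
Proof. by apply/rowP => i; rewrite !mxE null_integral. Qed.

Let null_vintegral2 (F : 'rV[R]_d * 'rV[R]_d -> 'rV[R]_d) : vintegral P F = 0.
Proof. by apply/rowP => i; rewrite !mxE null_integral. Qed.

Lemma null_reflectionless : reflectionless s mu.
Proof.
split.
- split => [x|Q _]; first by rewrite mu0//; exact: measurable_set1_rV.
  apply/integrableP; split; last by rewrite null_integral.
  apply: measurable_funTS; apply/measurable_EFinP.
  exact: measurable_enorm_diff_powR.
- by rewrite /restricted_growth null_integral.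
- move=> f _ _; rewrite /riesz_pairing1 /riesz_pairing.
  by rewrite null_vintegral null_vintegral2 addr0.
Qed.

Lemma null_finite_energy : (\int[P]_z energy_density s z < +oo)%E.
Proof. by rewrite null_integral. Qed.

End null_reflectionless.

Theorem proposition10p2 (R : realType) (d : nat) (s : R)
    (hs0 : 0 < s) (hsd : s < d%:R)
    (mu : {measure set 'rV[R]_d -> \bar R}) (hmu : locally_finite mu) :
  (reflectionless s mu /\
   (\int[(mu \x mu)%E]_z energy_density s z < +oo)%E) <->
  (forall A : set 'rV[R]_d, measurable A -> mu A = 0%E).
Proof.
split=> [[[[no_atom _] _ orth] finite_energy] A mA|mu0]; last first.
  by split; [exact: null_reflectionless|exact: null_finite_energy].
(* Fubini's theorem asks for a bundled sigma-finite measure: [nu] is [mu] with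
   that structure, so that both have the same integrals by conversion. *)
have sf := locally_finite_sigma_finite hmu.
pose mu_sigma_finite := isSigmaFinite.Build _ _ _ _ sf.
pose mu_s_finite := isSFinite.Build _ _ _ _ (sfinite_measure_sigma_finite sf).
pose nu := HB.pack_for (SigmaFiniteMeasure.type 'rV[R]_d R) (Measure.sort mu)
  mu_s_finite mu_sigma_finite.
have nu0 : nu setT = 0%E.
  exact: (@reflectionless_null R d s nu hmu finite_energy no_atom orth).
apply/eqP; rewrite -measure_le0 -[leRHS]nu0.
by apply: le_measure; rewrite ?inE.
Qed.
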